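(* Consider the $2$-user linear deterministic Z interference channel with parameters $(m,n)$, with unidirectional transmitter cooperation of rate $C$ from transmitter $2$ to transmitter $1$ and with the secrecy constraint at receiver $1$. Let $\alpha=n/m$ and suppose $0\le\alpha\le 1$ (weak and moderate interference regimes). Then every rate pair $(R_1,R_2)$ in the secrecy capacity region satisfies $$R_1\le m,\qquad R_2\le m,\qquad R_1+R_2\le 2m-n+C.$$
   Context: Linear deterministic Z interference channel: let $m\ge 1$, $n\ge 0$ be integers and $q=\max\{m,n\}$. In each channel use, transmitter $1$ sends a binary vector $\mathbf{x}_1$ of length $m$ and transmitter $2$ sends a binary vector $\mathbf{x}_2$ of length $q$ (a vector shorter than $q$ is regarded as occupying the top entries of a length-$q$ vector, the remaining entries being $0$). The outputs are $$\mathbf{y}_1=\mathbf{D}^{q-m}\mathbf{x}_1\oplus\mathbf{D}^{q-n}\mathbf{x}_2,\qquad \mathbf{y}_2=\mathbf{D}^{q-m}\mathbf{x}_2,$$ where $\oplus$ is entrywise addition modulo $2$ and $\mathbf{D}$ is the $q\times q$ downshift matrix with entries $d_{j',j''}=1$ if $2\le j'=j''+1\le q$ and $0$ otherwise. Thus receiver $2$ observes the top $m$ bits of $\mathbf{x}_2$, and receiver $1$ observes the modulo-$2$ sum of the top $m$ bits of $\mathbf{x}_1$ and the top $n$ bits of $\mathbf{x}_2$, aligned at the bottom. The channel is used $N$ times without memory; $\mathbf{x}_i^N,\mathbf{y}_i^N$ denote the blocks of $N$ inputs and outputs. Messages and encoding: $W_1,W_2$ are independent and uniformly distributed, $W_i$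 on a set of size $2^{NR_i}$. A noiseless and secure cooperative link of rate $C\ge 0$ bits per channel use (an integer) goes from transmitter $2$ to transmitter $1$; the signal sent on it during the block is $\mathbf{v}_{21}^N$, with $H(\mathbf{v}_{21}^N)\le NC$. The signals $\mathbf{x}_2^N$ and $\mathbf{v}_{21}^N$ are functions of $W_2$ and possibly local randomness at transmitter $2$, so they are independent of $W_1$. The input of transmitter $1$ is a function of $W_1$, of the cooperative signal received so far (causality: it may not depend on cooperative signals sent in the future), and possibly of local randomness (artificial noise). The local randomness at the two transmitters is independent of each other and of the messages. In particular, $(W_1,\mathbf{x}_1^N)\to\mathbf{v}_{21}^N\to(W_2,\mathbf{x}_2^N)$ is a Markov chain. Secrecy capacity region: $(R_1,R_2)$ is achievable if there is a sequence of such codes with $N\to\infty$ for which receiver $i$ decodes $W_i$ from $\mathbf{y}_i^N$ with error probability tending to $0$ ($i=1,2$) and weak secrecy holds: $\frac1N I(W_2;\mathbf{y}_1^N)\to 0$. (Secrecy of $W_1$ at receiver $2$ is automatic, since transmitter $1$ is not connected to receiver $2$.) The secrecy capacity region is the closure of the set of achievable pairs. Entropies and mutual informations are in bits. *)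

(* Defs.v *)
From mathcomp Require Import all_boot all_order all_algebra.
From mathcomp Require Import all_classical all_reals all_analysis.
Set Implicit Arguments.
Unset Strict Implicit.
Unset Printing Implicit Defensive.
Import Order.TTheory GRing.Theory Num.Theory.
Import numFieldNormedType.Exports.
Local Open Scope classical_set_scope.
Local Open Scope ring_scope.

(* Information measures, in bits, of random variables with values in a finite
   type, on an arbitrary probability space. *)
Section Information.
Context d (T : measurableType d) (R : realType) (P : probability T R).

Definition discrete_measurable (F : finType) (X : T -> F) : Prop :=
  forall x, measurable (X @^-1` [set x]).

Definition pmf (F : finType) (X : T -> F) (x : F) : R :=
  fine (P (X @^-1` [set x])).

Definition log2 (x : R) : R := ln x / ln 2.

(* As [ln 0 = 0], terms of probability zero contribute zero. *)
Definition entropy (F : finType) (X : T -> F) : R :=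
  - \sum_x pmf X x * log2 (pmf X x).

Definition mutual_info (F G : finType) (X : T -> F) (Y : T -> G) : R :=
  \sum_x \sum_y
    let pxy := pmf (fun o => (X o, Y o)) (x, y) in
    pxy * log2 (pxy / (pmf X x * pmf Y y)).

End Information.

Arguments discrete_measurable {d T F} X.

(* The linear deterministic Z interference channel.  Bits are elements of
   ['F_2]; entry [0] of a column is the topmost bit. *)
Section Channel.
Variables m n : nat.
Let q := maxn m n.

Definition downshift : 'M['F_2]_q :=
  \matrix_(i, j) (if val i == (val j).+1 then 1 else 0).

Definition pad (x : 'cV['F_2]_m) : 'cV['F_2]_q :=
  \col_i (if insub (val i) is Some j then x j 0 else 0).

Definition output1 (x1 : 'cV['F_2]_m) (x2 : 'cV['F_2]_q) : 'cV['F_2]_q :=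
  downshift ^+ (q - m) *m pad x1 + downshift ^+ (q - n) *m x2.

Definition output2 (x2 : 'cV['F_2]_q) : 'cV['F_2]_q :=
  downshift ^+ (q - m) *m x2.

End Channel.

Arguments output1 : clear implicits.
Arguments output2 : clear implicits.

Definition block (N : nat) (F : finType) : finType := {ffun 'I_N -> F}.

(* A transmission scheme of block length [N] with message sets of sizes [M1]
   and [M2].  [A1] and [A2] are the local randomness of the transmitters; [V]
   is the alphabet of the cooperative link in one channel use. *)
Record scheme (R : realType) (m n N M1 M2 : nat) := Scheme {
  dOmega : measure_display;
  Omega : measurableType dOmega;
  Pr : probability Omega R;
  W1 : Omega -> 'I_M1;
  W2 : Omega -> 'I_M2;
  dS1 : measure_display;
  S1 : measurableType dS1;
  A1 : Omega -> S1;
  dS2 : measure_display;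
  S2 : measurableType dS2;
  A2 : Omega -> S2;
  V : finType;
  coop : 'I_M2 -> S2 -> block N V;
  enc2 : 'I_M2 -> S2 -> block N 'cV['F_2]_(maxn m n);
  enc1 : 'I_M1 -> block N V -> S1 -> block N 'cV['F_2]_m;
  dec1 : block N 'cV['F_2]_(maxn m n) -> 'I_M1;
  dec2 : block N 'cV['F_2]_(maxn m n) -> 'I_M2
}.

Arguments W1 {R m n N M1 M2} s _.
Arguments W2 {R m n N M1 M2} s _.
Arguments A1 {R m n N M1 M2} s _.
Arguments A2 {R m n N M1 M2} s _.
Arguments coop {R m n N M1 M2} s _ _.
Arguments enc1 {R m n N M1 M2} s _ _ _.
Arguments enc2 {R m n N M1 M2} s _ _.
Arguments dec1 {R m n N M1 M2} s _.
Arguments dec2 {R m n N M1 M2} s _.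

Section Signals.
Context (R : realType) (m n N M1 M2 : nat) (s : scheme R m n N M1 M2).
Implicit Type o : Omega s.

Definition v21 o : block N (V s) := coop s (W2 s o) (A2 s o).

Definition x2 o : block N 'cV['F_2]_(maxn m n) := enc2 s (W2 s o) (A2 s o).

Definition x1 o : block N 'cV['F_2]_m := enc1 s (W1 s o) (v21 o) (A1 s o).

Definition y1 o : block N 'cV['F_2]_(maxn m n) :=
  [ffun t => output1 m n (x1 o t) (x2 o t)].

Definition y2 o : block N 'cV['F_2]_(maxn m n) :=
  [ffun t => output2 m n (x2 o t)].

(* The product rule for four sets gives mutual independence: the rule for a
   subfamily is obtained by taking the other sets to be full. *)
Record is_code (C : nat) : Prop := IsCode {
  W1_meas : discrete_measurable (W1 s);
  W2_meas : discrete_measurable (W2 s);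
  A1_meas : measurable_fun setT (A1 s);
  A2_meas : measurable_fun setT (A2 s);
  coop_meas : forall w, discrete_measurable (coop s w);
  enc2_meas : forall w, discrete_measurable (enc2 s w);
  enc1_meas : forall w v, discrete_measurable (enc1 s w v);
  W1_uniform : forall w : 'I_M1, pmf (Pr s) (W1 s) w = M1%:R^-1;
  W2_uniform : forall w : 'I_M2, pmf (Pr s) (W2 s) w = M2%:R^-1;
  sources_independent :
    forall (E1 : set 'I_M1) (E2 : set 'I_M2) (B1 : set (S1 s)) (B2 : set (S2 s)),
      measurable B1 -> measurable B2 ->
      Pr s (W1 s @^-1` E1 `&` W2 s @^-1` E2 `&`
            A1 s @^-1` B1 `&` A2 s @^-1` B2) =
      (Pr s (W1 s @^-1` E1) * Pr s (W2 s @^-1` E2) *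
       Pr s (A1 s @^-1` B1) * Pr s (A2 s @^-1` B2))%E;
  enc1_causal :
    forall (w : 'I_M1) (v v' : block N (V s)) (a : S1 s) (t : 'I_N),
      (forall u : 'I_N, (u <= t)%N -> v u = v' u) ->
      enc1 s w v a t = enc1 s w v' a t;
  link_rate : entropy (Pr s) v21 <= N%:R * C%:R
}.

Definition error1 : R := fine (Pr s [set o | dec1 s (y1 o) <> W1 s o]).

Definition error2 : R := fine (Pr s [set o | dec2 s (y2 o) <> W2 s o]).

Definition leakage_rate : R :=
  mutual_info (Pr s) (W2 s) y1 / N%:R.

End Signals.

(* [2 ^ (N * r)] rounded up to an integer. *)
Definition message_count (R : realType) (N : nat) (r : R) : nat :=
  `|Num.ceil (2 `^ (N%:R * r))|%N.

Definition achievable (R : realType) (m n C : nat) (r : R * R) : Prop :=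
  [/\ 0 <= r.1, 0 <= r.2 &
    exists (N : nat -> nat)
           (s : forall k, scheme R m n (N k) (message_count (N k) r.1)
                                             (message_count (N k) r.2)),
      [/\ forall k, is_code (s k) C,
          N @ \oo --> \oo,
          (fun k => error1 (s k)) @ \oo --> (0 : R),
          (fun k => error2 (s k)) @ \oo --> (0 : R) &
          (fun k => leakage_rate (s k)) @ \oo --> (0 : R)]].

Arguments achievable : clear implicits.

Definition secrecy_capacity_region (R : realType) (m n C : nat) : set (R * R) :=
  closure [set r | achievable R m n C r].

Arguments secrecy_capacity_region : clear implicits.

(* Main.v *)
From Pilot Require Import Defs.
From mathcomp Require Import all_boot all_order all_algebra.
From mathcomp Require Import all_classical all_reals all_analysis.
From mathcomp Require Import ring lra.
(* all_analysis has its own [discrete_measurable]. *)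
Import Pilot.Defs.
Set Implicit Arguments.
Unset Strict Implicit.
Unset Printing Implicit Defensive.
Import Order.TTheory GRing.Theory Num.Theory.
Import numFieldNormedType.Exports.
Local Open Scope classical_set_scope.
Local Open Scope ring_scope.

(* The bounds on [R1] and [R2] are Fano's inequality.  For the sum rate, split
   [x2] into the part [Xa] that interferes at receiver 1 and the remaining
   [q - n] bits per channel use, so that
     [N R2 <= H(x2) + o(N) <= H(Xa) + N (q - n) + o(N)].
   Receiver 1 pays for the interference: let [E] be the random map by which
   transmitter 1 turns the cooperative signal [v] into its input.  The pair
   [U = (E, W1)] is independent of [(v, Xa)], and [(U, v, y1)] and [(U, v, Xa)]
   determine each other, whence
     [H(U) + H(v, Xa) = H(U, v, y1) <= H(E | W1) + H(W1, v, y1)],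
   i.e. [H(W1) + H(v, Xa) <= H(W1, v, y1) <= H(v) + H(y1) + o(N)] by Fano's
   inequality.  With [H(v) <= N C] and [H(y1) <= N q] this gives
   [N R1 + H(Xa) <= N C + N q + o(N)]. *)

(** * Laws of finite-valued random variables *)

Section FiniteRandomVariables.
Context d (T : measurableType d) (R : realType) (P : probability T R).
Implicit Types F G H : finType.

Lemma measurable_preimage_fin F (X : T -> F) (A : set F) :
  discrete_measurable X -> measurable (X @^-1` A).
Proof.
move=> mX; have -> : X @^-1` A = \bigcup_(x in A) (X @^-1` [set x]).
  by apply/seteqP; split=> o /= => [Ao|[x Ax /= ->]//]; exists (X o).
by apply: fin_bigcup_measurable => // *; exact: finite_finset.
Qed.

Lemma discrete_measurable_comp F G (f : F -> G) (X : T -> F) :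
  discrete_measurable X -> discrete_measurable (fun o => f (X o)).
Proof. by move=> mX y; exact: (measurable_preimage_fin (f @^-1` [set y]) mX). Qed.
Arguments discrete_measurable_comp {F G} f {X} _ _.

Lemma discrete_measurable_pair F G (X : T -> F) (Y : T -> G) :
  discrete_measurable X -> discrete_measurable Y ->
  discrete_measurable (fun o => (X o, Y o)).
Proof.
move=> mX mY [x y].
have -> : (fun o => (X o, Y o)) @^-1` [set (x, y)] =
    X @^-1` [set x] `&` Y @^-1` [set y].
  by apply/seteqP; split=> o /= [-> ->].
exact: measurableI.
Qed.
Arguments discrete_measurable_pair {F G X Y} _ _ _.

Lemma probability_sum_fibers F (X : T -> F) (B : set T) :
  measurable B -> discrete_measurable X ->
  fine (P B) = \sum_x fine (P (B `&` X @^-1` [set x])).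
Proof.
move=> mB mX; have mI x : measurable (B `&` X @^-1` [set x]) by exact: measurableI.
have BE : B = \bigcup_(x in [set: F]) (B `&` X @^-1` [set x]).
  by apply/seteqP; split=> o; [move=> Bo; exists (X o)|case=> x _ []].
rewrite {1}BE measure_fin_bigcup; [|exact: finite_finset| |by []]; last first.
  by move=> x y _ _ [t [[_ /= <-] [_ /= <-]]].
rewrite (eq_fsbigr (fun x => (fine (P (B `&` X @^-1` [set x])))%:E)); last first.
  by move=> x _; rewrite fineK// fin_num_measure.
rewrite fsumEFin/=; last exact: finite_finset.
have -> : [set: F] = [set` predT] by apply/seteqP; split.
by rewrite -(@bigfs _ _ _ _ (index_enum F))// ?index_enum_uniq// => x _;
  rewrite mem_index_enum.
Qed.

Lemma pmf_ge0 F (X : T -> F) x : 0 <= pmf P X x.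
Proof. by rewrite /pmf fine_ge0. Qed.

Lemma pmf_comp F G (f : F -> G) (X : T -> F) y : discrete_measurable X ->
  pmf P (fun o => f (X o)) y = \sum_(x | f x == y) pmf P X x.
Proof.
move=> mX; rewrite /pmf (probability_sum_fibers _ mX); last first.
  exact: discrete_measurable_comp.
rewrite [RHS]big_mkcond; apply: eq_bigr => x _; case: eqP => [<-|nfx].
  by congr (fine (P _)); apply/seteqP; split=> [t /= []//|t /= ->].
rewrite (_ : _ `&` _ = set0) ?measure0//.
by apply/seteqP; split=> // o /= [fX xo]; apply: nfx; rewrite -xo.
Qed.

Lemma sum_pmf F (X : T -> F) : discrete_measurable X -> \sum_x pmf P X x = 1.
Proof.
move=> mX; have := probability_sum_fibers measurableT mX.
by rewrite probability_setT/= => ->; apply: eq_bigr => x _; rewrite setTI.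
Qed.

(** Change of variables for expectations: grouping the values of [X] by their image under [f] turns
    the right side into the left one. *)
Lemma sum_pmf_comp F G (f : F -> G) (X : T -> F) (g : G -> R) :
  discrete_measurable X ->
  \sum_y pmf P (fun o => f (X o)) y * g y = \sum_x pmf P X x * g (f x).
Proof.
move=> mX; rewrite [RHS](partition_big f predT)//=; apply: eq_bigr => y _.
by rewrite pmf_comp// mulr_suml; apply: eq_bigr => x /eqP <-.
Qed.

Lemma pmf_comp_ge F G (f : F -> G) (X : T -> F) x : discrete_measurable X ->
  pmf P X x <= pmf P (fun o => f (X o)) (f x).
Proof.
move=> mX; rewrite pmf_comp// (bigD1 x)//= lerDl sumr_ge0// => z _.
exact: pmf_ge0.
Qed.

Lemma pmf_le1 F (X : T -> F) x : discrete_measurable X -> pmf P X x <= 1.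
Proof.
move=> mX; rewrite -(sum_pmf mX) (bigD1 x)//= lerDl sumr_ge0// => z _.
exact: pmf_ge0.
Qed.

(** * Binary logarithms and entropy inequalities *)

Lemma log2M (x y : R) : 0 < x -> 0 < y -> log2 (x * y) = log2 x + log2 y.
Proof. by move=> x0 y0; rewrite /log2 lnM// mulrDl. Qed.

Lemma log2V (x : R) : 0 < x -> log2 x^-1 = - log2 x.
Proof. by move=> x0; rewrite /log2 lnV// mulNr. Qed.

Let ln2_gt0 : 0 < ln 2 :> R. Proof. by rewrite ln_gt0// ltr1n. Qed.

Lemma log2_2 : log2 2 = 1 :> R.
Proof. by rewrite /log2 divff// gt_eqF. Qed.

Lemma log2X (n : nat) : log2 (2 ^+ n) = n%:R :> R.
Proof.
by rewrite /log2 lnXn// -[_ *+ n]mulr_natl mulfK// gt_eqF.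
Qed.

Lemma ler_log2 (x y : R) : 0 < x -> x <= y -> log2 x <= log2 y.
Proof.
move=> x0 xy; rewrite /log2 ler_pM2r ?invr_gt0// ler_ln// posrE//.
exact: lt_le_trans xy.
Qed.

(** Termwise consequence of [ln t <= t - 1] at [t = r x / p x]; the errors sum to
    [(1 - \sum_x r x) / ln 2 >= 0], so a subprobability [r] suffices. Positivity of [r] on the
    support of [X] guards against the convention [ln 0 = 0]. *)
Lemma gibbs F (X : T -> F) (r : F -> R) : discrete_measurable X ->
    (forall x, 0 <= r x) -> \sum_x r x <= 1 ->
    (forall x, 0 < pmf P X x -> 0 < r x) ->
  entropy P X <= - \sum_x pmf P X x * log2 (r x).
Proof.
move=> mX r0 r1 pr; rewrite /entropy lerN2 -subr_ge0 -sumrB.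
have le x : (pmf P X x - r x) / ln 2 <=
    pmf P X x * log2 (pmf P X x) - pmf P X x * log2 (r x).
  have [p0|p0] := eqVneq (pmf P X x) 0.
    rewrite p0 !mul0r subrr sub0r pmulr_lle0 ?invr_gt0// oppr_le0.
    exact: r0.
  have pp : 0 < pmf P X x by rewrite lt_neqAle eq_sym p0 pmf_ge0.
  have rp := pr x pp.
  rewrite /log2 !mulrA -mulrBl ler_pM2r ?invr_gt0//.
  have := @le_ln1Dx R (r x / pmf P X x - 1); rewrite ltrDr divr_gt0// => /(_ isT).
  rewrite addrC subrK ln_div// => /(ler_wpM2l (ltW pp)).
  rewrite !mulrBr mulrCA divff// !mulr1 => H; lra.
apply: le_trans (ler_sum _ (fun x _ => le x)).
by rewrite -mulr_suml sumrB sum_pmf// divr_ge0 ?subr_ge0// ltW.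
Qed.

(** Writing the entropy as an expectation under the law of [X] lets entropies of several functions
    of one variable be compared term by term. *)
Lemma entropy_comp F G (f : F -> G) (X : T -> F) : discrete_measurable X ->
  entropy P (fun o => f (X o)) =
  - \sum_x pmf P X x * log2 (pmf P (fun o => f (X o)) (f x)).
Proof. by move=> mX; rewrite -(sum_pmf_comp f (fun y => log2 (pmf P _ y)) mX). Qed.

Lemma entropy_comp_le F G (f : F -> G) (X : T -> F) : discrete_measurable X ->
  entropy P (fun o => f (X o)) <= entropy P X.
Proof.
move=> mX; rewrite entropy_comp// lerN2; apply: ler_sum => x _.
have [->|p0] := eqVneq (pmf P X x) 0; first by rewrite !mul0r.
by rewrite ler_wpM2l ?pmf_ge0// ler_log2 ?pmf_comp_ge// lt_neqAle eq_sym p0 pmf_ge0.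
Qed.

Lemma entropy_inj F G (f : F -> G) (X : T -> F) : injective f ->
  discrete_measurable X -> entropy P (fun o => f (X o)) = entropy P X.
Proof.
move=> inj_f mX; rewrite entropy_comp//; congr (- _); apply: eq_bigr => x _.
congr (_ * log2 (fine (P _))); apply/seteqP; split=> o /=; first exact: inj_f.
by move=> ->.
Qed.

Lemma entropy_le_card F (X : T -> F) : discrete_measurable X ->
  entropy P X <= log2 #|F|%:R.
Proof.
move=> mX; have [F0|Fpos] := posnP #|F|.
  have : (0 : R) = 1.
    rewrite -(sum_pmf mX) big1// => x _.
    by have := max_card (pred1 x); rewrite card1 F0.
  by move/eqP; rewrite eq_sym oner_eq0.
have cF : 0 < #|F|%:R :> R by rewrite ltr0n.
apply: le_trans (gibbs (r := fun=> #|F|%:R^-1) mX _ _ _) _.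
- by move=> x; rewrite invr_ge0 ltW.
- by rewrite sumr_const -[_ *+ _]mulr_natl divff// gt_eqF.
- by move=> x _; rewrite invr_gt0.
- by rewrite -mulr_suml sum_pmf// mul1r log2V// opprK.
Qed.

Lemma entropy_uniform (M : nat) (W : T -> 'I_M) :
    (forall w, pmf P W w = M%:R^-1) -> discrete_measurable W ->
  entropy P W = log2 M%:R.
Proof.
move=> uW mW; have [M0|Mpos] := posnP M.
  (* For [M = 0] both sides vanish: the sum is empty and [ln 0 = 0]. *)
  by subst M; rewrite /entropy big_ord0 /log2 ln0// mul0r oppr0.
rewrite /entropy; under eq_bigr do rewrite {2}uW.
by rewrite -mulr_suml sum_pmf// mul1r log2V ?ltr0n// opprK.
Qed.

Lemma pmf_gt0_comp F G (f : F -> G) (X : T -> F) x : discrete_measurable X ->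
  0 < pmf P X x -> 0 < pmf P (fun o => f (X o)) (f x).
Proof. by move=> mX /lt_le_trans; apply; exact: pmf_comp_ge. Qed.

Lemma sum_pmf_snd F G (X : T -> F) (Z : T -> G) z :
    discrete_measurable X -> discrete_measurable Z ->
  \sum_x pmf P (fun o => (X o, Z o)) (x, z) = pmf P Z z.
Proof.
move=> mX mZ; have mXZ := discrete_measurable_pair mX mZ.
rewrite [RHS](@pmf_comp _ _ snd (fun o => (X o, Z o)))//.
rewrite (eq_bigr (fun i => pmf P (fun o => (X o, Z o)) (i.1, i.2))); last by case.
rewrite -(pair_big predT (pred1 z)
  (fun x z => pmf P (fun o => (X o, Z o)) (x, z)))/=.
by apply: eq_bigr => x _; rewrite big_pred1_eq.
Qed.

(** Nonnegativity of the conditional mutual information of [X] and [Y] given [Z]: Gibbs' inequality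
    against [p(x,z) p(y,z) / p(z)], the law with the same [(X, Z)] and [(Y, Z)] marginals that makes
    [X] and [Y] conditionally independent. *)
Lemma entropy_submodular F G H (X : T -> F) (Y : T -> G) (Z : T -> H) :
    discrete_measurable X -> discrete_measurable Y -> discrete_measurable Z ->
  entropy P (fun o => (X o, Y o, Z o)) + entropy P Z <=
  entropy P (fun o => (X o, Z o)) + entropy P (fun o => (Y o, Z o)).
Proof.
move=> mX mY mZ.
have mXZ := discrete_measurable_pair mX mZ.
have mYZ := discrete_measurable_pair mY mZ.
pose V o := (X o, Y o, Z o).
have mV : discrete_measurable V.
  by apply: discrete_measurable_pair => //; exact: discrete_measurable_pair.
pose pxz := pmf P (fun o => (X o, Z o)); pose pyz := pmf P (fun o => (Y o, Z o)).
pose r (v : F * G * H) := pxz (v.1.1, v.2) * pyz (v.1.2, v.2) / pmf P Z v.2.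
have pos v : 0 < pmf P V v ->
    [/\ 0 < pxz (v.1.1, v.2), 0 < pyz (v.1.2, v.2) & 0 < pmf P Z v.2].
  move=> v0; split.
  - exact: (@pmf_gt0_comp _ _ (fun v => (v.1.1, v.2)) V).
  - exact: (@pmf_gt0_comp _ _ (fun v => (v.1.2, v.2)) V).
  - exact: (@pmf_gt0_comp _ _ snd V).
rewrite -lerBrDr; apply: le_trans (gibbs (r := r) mV _ _ _) _.
- by move=> v; rewrite divr_ge0 ?mulr_ge0 ?pmf_ge0.
(* Total mass of [r]: summing over [x] and [y] for fixed [z] leaves [p(z) p(z) / p(z)], which is
   [p(z)] also when [p(z) = 0]. *)
- rewrite (eq_bigr (fun v => r (v.1, v.2))); last by case.
  rewrite -(pair_bigA _ (fun v z => r (v, z)))/= exchange_big/=.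
  rewrite -(sum_pmf mZ); apply: ler_sum => z _.
  rewrite (eq_bigr (fun v => r (v.1, v.2, z))); last by case.
  rewrite -(pair_bigA _ (fun x y => r (x, y, z)))/= /r/=.
  under eq_bigr => x _ do rewrite -mulr_suml -mulr_sumr sum_pmf_snd//.
  rewrite -mulr_suml -mulr_suml sum_pmf_snd//.
  have [->|nz] := eqVneq (pmf P Z z) 0; first by rewrite !mul0r.
  by rewrite mulfK.
- by move=> v /pos[xz yz z]; rewrite divr_gt0 ?mulr_gt0.
- rewrite le_eqVlt; apply/orP; left; apply/eqP.
  rewrite (@entropy_comp _ _ (fun v => (v.1.1, v.2)) V)//.
  rewrite (@entropy_comp _ _ (fun v => (v.1.2, v.2)) V)//.
  rewrite (@entropy_comp _ _ snd V)// -!sumrN -!big_split/=.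
  apply: eq_bigr => v _.
  have [->|nz] := eqVneq (pmf P V v) 0; first by rewrite !mul0r; lra.
  have /pos[xz yz z] : 0 < pmf P V v by rewrite lt_neqAle eq_sym nz pmf_ge0.
  rewrite /r log2M ?mulr_gt0 ?invr_gt0// log2M// log2V//.
  rewrite /pxz /pyz; lra.
Qed.

Lemma entropy_subadditive F G (X : T -> F) (Y : T -> G) :
    discrete_measurable X -> discrete_measurable Y ->
  entropy P (fun o => (X o, Y o)) <= entropy P X + entropy P Y.
Proof.
move=> mX mY.
have mC : discrete_measurable (fun _ : T => tt).
  exact: (discrete_measurable_comp (fun=> tt) mX).
have := entropy_submodular mX mY mC.
rewrite (@entropy_inj _ _ (fun x => (x, tt)) X)//; last by move=> ? ? [].
rewrite (@entropy_inj _ _ (fun x => (x, tt)) Y)//; last by move=> ? ? [].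
rewrite (@entropy_inj _ _ (fun x => (x, tt)) (fun o => (X o, Y o)))//; last first.
- exact: discrete_measurable_pair.
- by move=> ? ? [].
apply: le_trans; rewrite lerDl.
rewrite /entropy -sumrN sumr_ge0// => u _; rewrite -mulrN mulr_ge0 ?pmf_ge0//.
rewrite oppr_ge0 /log2 pmulr_lle0 ?invr_gt0// ln_le0// pmf_le1//.
Qed.

Lemma entropy_independent F G (X : T -> F) (Y : T -> G) :
    discrete_measurable X -> discrete_measurable Y ->
    (forall x y, pmf P (fun o => (X o, Y o)) (x, y) = pmf P X x * pmf P Y y) ->
  entropy P (fun o => (X o, Y o)) = entropy P X + entropy P Y.
Proof.
move=> mX mY XY; have mXY := discrete_measurable_pair mX mY.
pose Z o := (X o, Y o).
rewrite (@entropy_comp _ _ fst Z)// (@entropy_comp _ _ snd Z)//.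
rewrite -opprD -big_split/=; congr (- _); apply: eq_bigr => -[x y] _.
rewrite -mulrDr; have [->|nz] := eqVneq (pmf P Z (x, y)) 0; first by rewrite !mul0r.
have z0 : 0 < pmf P Z (x, y) by rewrite lt_neqAle eq_sym nz pmf_ge0.
rewrite XY log2M//; first exact: (@pmf_gt0_comp _ _ fst Z (x, y)).
exact: (@pmf_gt0_comp _ _ snd Z (x, y)).
Qed.

(* Gibbs' inequality against the law which, given [Y = y], puts mass [1/2] on
   [dec y] and spreads the other half uniformly. *)
Lemma fano (M : nat) G (W : T -> 'I_M) (Y : T -> G) (dec : G -> 'I_M) :
    discrete_measurable W -> discrete_measurable Y ->
  entropy P (fun o => (W o, Y o)) <= entropy P Y + 1 +
    fine (P [set o | dec (Y o) <> W o]) * log2 M%:R.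
Proof.
move=> mW mY; have mWY := discrete_measurable_pair mW mY.
pose Z o := (W o, Y o); pose e (z : 'I_M * G) := dec z.2 != z.1.
have M0 : 0 < M%:R :> R.
  rewrite ltr0n; case: (M) W {dec e Z mWY} mW => // W mW.
  by have := sum_pmf mW; rewrite big_ord0 => /eqP; rewrite eq_sym oner_eq0.
pose k z := if e z then (2 * M%:R)^-1 else (2 : R)^-1 .
pose r z := pmf P Y z.2 * k z.
have k0 z : 0 < k z by rewrite /k; case: ifP; rewrite invr_gt0 ?mulr_gt0.
have errE : fine (P [set o | dec (Y o) <> W o]) =
    pmf P (fun o => e (Z o)) true.
  congr (fine (P _)); apply/seteqP; split=> o /=; first by move/eqP.
  by rewrite /e => /eqP.
apply: le_trans (gibbs (r := r) mWY _ _ _) _.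
- by move=> z; rewrite mulr_ge0 ?pmf_ge0// ltW.
- rewrite (eq_bigr (fun v => r (v.1, v.2))); last by case.
  rewrite -(pair_bigA _ (fun v z => r (v, z)))/= exchange_big/=.
  rewrite -(sum_pmf mY); apply: ler_sum => y _.
  rewrite /r/= -mulr_sumr ler_piMr ?pmf_ge0//.
  rewrite (bigD1 (dec y))//= /k /e/= eqxx/=.
  rewrite (eq_bigr (fun=> (2 * M%:R)^-1)); last by move=> w; rewrite eq_sym => ->.
  rewrite sumr_const cardC1 card_ord.
  (* The [M - 1] wrong messages together receive at most [1/2], so the total mass stays below
     [1]. *)
  have : (2 * M%:R)^-1 *+ M.-1 <= (2 * M%:R)^-1 *+ M :> R.
    by apply: ler_wpMn2l; rewrite ?leq_pred// invr_ge0 mulr_ge0 ?ltW.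
  have -> : (2 * M%:R)^-1 *+ M = 2^-1 :> R.
    by rewrite -[LHS]mulr_natr invfM mulfVK// gt_eqF.
  lra.
- by move=> z z0; rewrite mulr_gt0//; exact: (@pmf_gt0_comp _ _ snd Z).
rewrite (@entropy_comp _ _ snd Z)//.
(* The factor [k] costs one bit always, and [log2 M] more on a decoding error. *)
have -> : \sum_x pmf P Z x * log2 (r x) =
    \sum_x pmf P Z x * log2 (pmf P Y x.2) -
    \sum_x pmf P Z x * (1 + (e x)%:R * log2 M%:R).
  rewrite -sumrB; apply: eq_bigr => z _.
  have [->|nz] := eqVneq (pmf P Z z) 0; first by rewrite !mul0r subrr.
  have z0 : 0 < pmf P Z z by rewrite lt_neqAle eq_sym nz pmf_ge0.
  rewrite -mulrBr /r log2M//; last exact: (@pmf_gt0_comp _ _ snd Z).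
  congr (_ * (_ + _)); rewrite /k; case: (e z).
    by rewrite log2V ?mulr_gt0// log2M// log2_2 mul1r.
  by rewrite log2V// log2_2 mul0r addr0.
rewrite opprB addrC -[leRHS]addrA lerD2l; under eq_bigr do rewrite mulrDr mulr1.
rewrite big_split/= sum_pmf// lerD2l errE.
rewrite -(sum_pmf_comp e (fun b => b%:R * log2 M%:R) mWY)//.
by rewrite big_bool/= mul0r mulr0 addr0 mul1r.
Qed.

Lemma entropyC F G (X : T -> F) (Y : T -> G) :
    discrete_measurable X -> discrete_measurable Y ->
  entropy P (fun o => (X o, Y o)) = entropy P (fun o => (Y o, X o)).
Proof.
move=> mX mY; have mYX := discrete_measurable_pair mY mX.
rewrite -(entropy_inj (f := fun z => (z.2, z.1)) _ mYX)//.
by move=> [a b] [a' b'] [-> ->].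
Qed.

(** Submodularity conditioned on [g Y] gives [H(X,Y) + H(g Y) <= H(X, g Y) + H(Y)]; independence
    splits [H(X,Y)] and [H(Y)] cancels. *)
Lemma entropy_independent_comp F G H (g : G -> H) (X : T -> F) (Y : T -> G) :
    discrete_measurable X -> discrete_measurable Y ->
    (forall x y, pmf P (fun o => (X o, Y o)) (x, y) = pmf P X x * pmf P Y y) ->
  entropy P X + entropy P (fun o => g (Y o)) <=
  entropy P (fun o => (X o, g (Y o))).
Proof.
move=> mX mY XY; have mXY := discrete_measurable_pair mX mY.
have mg := discrete_measurable_comp g mY.
have := entropy_submodular mX mY mg.
rewrite (entropy_inj (f := fun y => (y, g y)) _ mY); last by move=> ? ? [].
rewrite (entropy_inj (f := fun z => (z, g z.2)) _ mXY); last by move=> ? ? [].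
rewrite entropy_independent//; lra.
Qed.

Lemma decoder_entropy_le (M : nat) G (W : T -> 'I_M) (Y : T -> G)
    (dec : G -> 'I_M) :
    discrete_measurable W -> discrete_measurable Y ->
  entropy P W <= entropy P Y + 1 +
    fine (P [set o | dec (Y o) <> W o]) * log2 M%:R.
Proof.
move=> mW mY; apply: le_trans (fano dec mW mY).
exact: (entropy_comp_le fst (discrete_measurable_pair mW mY)).
Qed.

End FiniteRandomVariables.

Arguments discrete_measurable_comp {d T F G} f {X} _ _.
Arguments discrete_measurable_pair {d T F G X Y} _ _ _.

(** * Measurability of encoder outputs *)

Section Measurability.
Context d d' (T : measurableType d) (S : measurableType d').

(** Encoders are measurable in the local randomness only for each fixed message; partitioning by the
    finitely many messages gives joint measurability. *)
Lemma discrete_measurable_family (F G : finType) (W : T -> F) (A : T -> S)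
    (f : F -> S -> G) :
    discrete_measurable W -> measurable_fun setT A ->
    (forall w, discrete_measurable (f w)) ->
  discrete_measurable (fun o => f (W o) (A o)).
Proof.
move=> mW mA mf y.
have -> : (fun o => f (W o) (A o)) @^-1` [set y] =
    \bigcup_(w in [set: F]) (W @^-1` [set w] `&` A @^-1` (f w @^-1` [set y])).
  by apply/seteqP; split=> t /=; [exists (W t)|case=> w _ [/= <-]].
apply: fin_bigcup_measurable => [|w _]; first exact: finite_finset.
apply: measurableI => //; rewrite -[X in measurable X]setTI.
by apply: mA => //; exact: mf.
Qed.

Lemma discrete_measurable_ffun (F G : finType) (g : F -> S -> G) :
    (forall x, discrete_measurable (g x)) ->
  discrete_measurable (fun a => [ffun x => g x a]).
Proof.
move=> mg h.
have -> : (fun a => [ffun x => g x a]) @^-1` [set h] =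
    \bigcap_(x in [set: F]) g x @^-1` [set h x].
  apply/seteqP; split=> t /= => [<- x _ /=|tx]; first by rewrite ffunE.
  by apply/ffunP => x; rewrite ffunE; exact: tx.
by apply: fin_bigcap_measurable => [|x _]; [exact: finite_finset|exact: mg].
Qed.

End Measurability.

(** * Bit levels of the channel *)

Section Bits.
Context (m n : nat).
Let q := maxn m n.

Lemma downshift_exp k (x : 'cV['F_2]_q) (i : 'I_q) (j : 'I_q) :
  (i = j + k :> nat)%N -> (downshift m n ^+ k *m x) i 0 = x j 0.
Proof.
elim: k i => [|k IH] i.
  by rewrite addn0 => /val_inj ->; rewrite expr0 mul1mx.
rewrite addnS => ij; rewrite exprS -[_ * _]/(_ *m _) -mulmxA mxE.
have jk : (j + k < q)%N by rewrite -ij ltnW.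
rewrite (bigD1 (Ordinal jk))//= mxE/= ij eqxx mul1r big1 ?addr0; last first.
  move=> l nl; rewrite mxE /= ij eqSS; case: eqP => [e|]; last by rewrite mul0r.
  by case/eqP: nl; apply/val_inj.
exact: IH.
Qed.

Lemma lower_index (i : 'I_(q - n)) : (n + i < q)%N.
Proof. by rewrite -ltn_subRL. Qed.

(** The entries that [downshift ^+ (q - n)] pushes off the bottom, hence those that never reach
    receiver 1. *)
Definition lower_bits (x : 'cV['F_2]_q) : 'cV['F_2]_(q - n) :=
  \col_i x (Ordinal (lower_index i)) 0.

(** Entry [i] is read off the lower bits if [n <= i], and at position [i + (q - n)] of the shifted
    vector otherwise. *)
Lemma downshift_lower_inj :
  injective (fun x => (downshift m n ^+ (q - n) *m x, lower_bits x)).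
Proof.
move=> x y [/colP hi /colP lo]; apply/colP => i.
have [ni|ni] := leqP n i.
  have iq : (i - n < q - n)%N by rewrite ltn_sub2r// (leq_ltn_trans ni).
  have := lo (Ordinal iq); rewrite !mxE.
  by rewrite (_ : Ordinal _ = i)//; apply/val_inj; rewrite /= subnKC.
have iq : (i + (q - n) < q)%N.
  by rewrite -[X in (_ < X)%N](subnKC (leq_maxr m n)) ltn_add2r.
by have := hi (Ordinal iq); rewrite !(@downshift_exp _ _ _ i).
Qed.

Lemma log2_card_block (R : realType) (N k : nat) :
  log2 #|block N 'cV['F_2]_k|%:R = N%:R * k%:R :> R.
Proof.
by rewrite card_ffun card_mx card_Fp// card_ord muln1 -expnM natrX log2X natrM mulrC.
Qed.

End Bits.

(** * Converse bounds for a code of fixed block length *)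

Section Converse.
Context (R : realType) (m n N M1 M2 C : nat) (s : scheme R m n N M1 M2).
Context (code : is_code s C).

Let P := Pr s.
Let q := maxn m n.

(* Finite-valued, unlike the local randomness [A1 s]. *)
Let E o : {ffun block N (V s) -> block N 'cV['F_2]_m} :=
  [ffun v => enc1 s (W1 s o) v (A1 s o)].

Let mW1 := W1_meas code.
Let mW2 := W2_meas code.

Let mE : discrete_measurable E.
Proof.
apply: (discrete_measurable_family (f := fun w a => [ffun v => enc1 s w v a]) mW1).
  exact: A1_meas code.
by move=> w; apply: discrete_measurable_ffun => v; exact: enc1_meas code w v.
Qed.

Let mv : discrete_measurable (v21 (s := s)).
Proof.
apply: (discrete_measurable_family mW2); [exact: A2_meas code|exact: coop_meas code].
Qed.

Let mx : discrete_measurable (x2 (s := s)).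
Proof.
apply: (discrete_measurable_family mW2); [exact: A2_meas code|exact: enc2_meas code].
Qed.

Let U o := (E o, W1 s o).
Let Z o := (W2 s o, (v21 o, x2 o)).

Let mU : discrete_measurable U := discrete_measurable_pair mE mW1.
Let mvx := discrete_measurable_pair mv mx.
Let mZ : discrete_measurable Z := discrete_measurable_pair mW2 mvx.

(** [U] depends on [(W1, A1)] alone and [Z] on [(W2, A2)] alone. As [U] and [Z] contain the
    messages, each of their values fixes a message, so its event is a product event to which the
    product rule applies. *)
Lemma transmitters_independent u z :
  pmf P (fun o => (U o, Z o)) (u, z) = pmf P U u * pmf P Z z.
Proof.
case: u z => e w1 [w2 [v x]].
pose B1 := [set a | [ffun v => enc1 s w1 v a] = e].
pose B2 := [set a | coop s w2 a = v /\ enc2 s w2 a = x].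
have mB1 : measurable B1.
  exact: (discrete_measurable_ffun (fun v => enc1_meas code w1 v) e).
have mB2 : measurable B2.
  have -> : B2 = (coop s w2) @^-1` [set v] `&` (enc2 s w2) @^-1` [set x] by [].
  by apply: measurableI; [exact: coop_meas code w2 v|exact: enc2_meas code w2 x].
have ind := sources_independent code.
have UE : U @^-1` [set (e, w1)] = W1 s @^-1` [set w1] `&` W2 s @^-1` setT `&`
    A1 s @^-1` B1 `&` A2 s @^-1` setT.
  rewrite !preimage_setT !setIT; apply/seteqP; split=> t; rewrite /U /E /B1 /=.
    by move=> [<- <-].
  by move=> [<- /= <-].
have ZE : Z @^-1` [set (w2, (v, x))] = W1 s @^-1` setT `&` W2 s @^-1` [set w2] `&`
    A1 s @^-1` setT `&` A2 s @^-1` B2.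
  rewrite !preimage_setT !setTI setIT.
  apply/seteqP; split=> t; rewrite /Z /v21 /x2 /B2 /=.
    by move=> [<- <- <-].
  by move=> [<- /= [<- <-]].
have UZE : (fun o => (U o, Z o)) @^-1` [set ((e, w1), (w2, (v, x)))] =
    W1 s @^-1` [set w1] `&` W2 s @^-1` [set w2] `&`
    A1 s @^-1` B1 `&` A2 s @^-1` B2.
  have -> : (fun o => (U o, Z o)) @^-1` [set ((e, w1), (w2, (v, x)))] =
      U @^-1` [set (e, w1)] `&` Z @^-1` [set (w2, (v, x))].
    apply/seteqP; split=> t; last by move=> [eU eZ]; exact: (congr2 pair eU eZ).
    by move=> eUZ; split; [exact: (congr1 fst eUZ)|exact: (congr1 snd eUZ)].
  rewrite UE ZE !preimage_setT !setTI !setIT.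
  by apply/seteqP; split=> t /= => [[[? ?] [? ?]]|[[[? ?] ?] ?]].
have mA1 : measurable (A1 s @^-1` B1).
  by rewrite -[X in measurable X]setTI; exact: (A1_meas code).
have mA2 : measurable (A2 s @^-1` B2).
  by rewrite -[X in measurable X]setTI; exact: (A2_meas code).
rewrite /pmf UZE UE ZE !ind// !preimage_setT !probability_setT !mule1 !mul1e.
rewrite -fineM ?fin_numM ?fin_num_measure//.
congr fine; rewrite -!muleA; congr (_ * _)%E.
by rewrite muleCA.
Qed.

Let interference (x : block N 'cV['F_2]_q) : block N 'cV['F_2]_q :=
  [ffun t => downshift m n ^+ (q - n) *m x t].

Let unheard (x : block N 'cV['F_2]_q) : block N 'cV['F_2]_(q - n) :=
  [ffun t => lower_bits (x t)].

Let Xa (o : Omega s) := interference (x2 o).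

Let Xb (o : Omega s) := unheard (x2 o).

Let mXa : discrete_measurable Xa := discrete_measurable_comp interference mx.

Let mXb : discrete_measurable Xb := discrete_measurable_comp unheard mx.

Let mvXa := discrete_measurable_pair mv mXa.

(* Given the cooperative signal and the encoding map [E], the output of
   receiver 1 and the interference determine each other. *)
Let g (e : {ffun block N (V s) -> block N 'cV['F_2]_m}) v
    (x : block N 'cV['F_2]_q) : block N 'cV['F_2]_q :=
  [ffun t => downshift m n ^+ (q - m) *m pad n (e v t) + x t].

Let y1E o : y1 o = g (E o) (v21 o) (Xa o).
Proof. by apply/ffunP => t; rewrite !ffunE. Qed.

Let my1 : discrete_measurable (y1 (s := s)).
Proof.
have -> : y1 (s := s) = fun o => g (E o) (v21 o) (Xa o).
  by apply/funext => o; exact: y1E.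
exact: (discrete_measurable_comp (fun z => g z.1 z.2.1 z.2.2)
  (discrete_measurable_pair mE mvXa)).
Qed.

Let my2 : discrete_measurable (y2 (s := s)).
Proof.
exact: (discrete_measurable_comp (fun x : block N 'cV['F_2]_q =>
  [ffun t => output2 m n (x t)] : block N 'cV['F_2]_q) mx).
Qed.

Let Hy1 : entropy P (y1 (s := s)) <= N%:R * q%:R.
Proof. by rewrite -log2_card_block; exact: entropy_le_card. Qed.

Let Hy2 : entropy P (y2 (s := s)) <= N%:R * q%:R.
Proof. by rewrite -log2_card_block; exact: entropy_le_card. Qed.

Lemma code_rate1 : log2 M1%:R <= N%:R * q%:R + 1 + error1 s * log2 M1%:R.
Proof.
rewrite -{1}(entropy_uniform (W1_uniform code) mW1).
apply: le_trans (decoder_entropy_le P (dec1 s) mW1 my1) _.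
by rewrite !lerD2r.
Qed.

Lemma code_rate2 : log2 M2%:R <= N%:R * q%:R + 1 + error2 s * log2 M2%:R.
Proof.
rewrite -{1}(entropy_uniform (W2_uniform code) mW2).
apply: le_trans (decoder_entropy_le P (dec2 s) mW2 my2) _.
by rewrite !lerD2r.
Qed.

Let interference_bound : log2 M1%:R + entropy P Xa <=
  N%:R * C%:R + N%:R * q%:R + 1 + error1 s * log2 M1%:R.
Proof.
have mvy := discrete_measurable_pair mv my1.
have indep : entropy P U + entropy P (fun o => (v21 o, Xa o)) <=
    entropy P (fun o => (U o, (v21 o, Xa o))).
  exact: (entropy_independent_comp (fun z => (z.2.1, interference z.2.2))
    mU mZ transmitters_independent).
have swap : entropy P (fun o => (U o, (v21 o, Xa o))) =
    entropy P (fun o => (E o, (v21 o, y1 o), W1 s o)).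
  rewrite -(entropy_inj P
    (f := fun z => (z.1.1, (z.2.1, g z.1.1 z.2.1 z.2.2), z.1.2))
    _ (discrete_measurable_pair mU mvXa)).
    by congr (entropy P _); apply/funext => o; rewrite /= -y1E.
  (* For equal [e] and [v], [g] translates [x] by a fixed vector, which cancels. *)
  move=> [[e w] [v x]] [[e' w'] [v' x']] /= [-> -> /ffunP gE ->].
  congr (_, (_, _)); apply/ffunP => t; have := gE t.
  by rewrite !ffunE => /addrI.
(* Conditioned on [W1], this yields [H(E, W1)], which is [H(U)] and cancels against [indep]. *)
have sub := entropy_submodular P mE mvy mW1.
have unif := entropy_uniform (W1_uniform code) mW1.
(* The decoder ignores the [v] component, so the error event is still that of [error1]. *)
have fan := fano P (fun z => dec1 s z.2) mW1 mvy.
have comm := entropyC P mW1 mvy.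
have vy := entropy_subadditive P mv my1.
have vx := entropy_comp_le P snd mvXa.
have link := link_rate code.
move: indep swap sub unif fan comm vy vx link Hy1.
rewrite /U /error1 /=.
lra.
Qed.

(** Adding the Fano bound for [W2] to [interference_bound] cancels [H(Xa)]; the constant [2]
    collects one bit from each use of Fano's inequality. *)
Lemma code_sum_rate : log2 M1%:R + log2 M2%:R <=
  N%:R * (C%:R + q%:R + (q - n)%:R) + 2 +
  error1 s * log2 M1%:R + error2 s * log2 M2%:R.
Proof.
have split_x : entropy P (x2 (s := s)) <= entropy P Xa + N%:R * (q - n)%:R.
  have mab := discrete_measurable_pair mXa mXb.
  have -> : entropy P (x2 (s := s)) = entropy P (fun o => (Xa o, Xb o)).
    symmetry.
    apply: (entropy_inj P (f := fun x => (interference x, unheard x)) _ mx).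
    move=> x x' [/ffunP xa /ffunP xb]; apply/ffunP => t.
    apply: (@downshift_lower_inj m n).
    by have := xa t; have := xb t; rewrite !ffunE => -> ->.
  apply: le_trans (entropy_subadditive P mXa mXb) _.
  by rewrite lerD2l -log2_card_block; exact: entropy_le_card.
have fan := decoder_entropy_le P (dec2 s) mW2 my2.
have unif := entropy_uniform (W2_uniform code) mW2.
have yx : entropy P (y2 (s := s)) <= entropy P (x2 (s := s)).
  exact: (entropy_comp_le P (fun x : block N 'cV['F_2]_q =>
    [ffun t => output2 m n (x t)] : block N 'cV['F_2]_q) mx).
move: split_x fan unif yx interference_bound.
rewrite /error2 /=.
lra.
Qed.

End Converse.

(** * Passage to the limit and to the closure *)

Section Asymptotics.
Context (R : realType).

Lemma log2_message_count (N : nat) (r : R) :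
  N%:R * r <= log2 (message_count N r)%:R.
Proof.
have p0 : 0 < 2 `^ (N%:R * r) :> R by rewrite powR_gt0.
have <- : log2 (2 `^ (N%:R * r)) = N%:R * r :> R.
  by rewrite /log2 ln_powR -mulrA -/(log2 2) log2_2 mulr1.
apply: ler_log2 => //; apply: le_trans (ceil_ge _) _.
by rewrite /message_count natr_absz ler_int ler_norm.
Qed.

(** The [L i] are only bounded below, so the error terms move to the left as [(1 - e i) * L i]
    before [L i] is replaced by [N * r i]; dividing by [N] and taking limits concludes. *)
Lemma asymptotic_rate_bound (N : nat -> nat) (e1 e2 L1 L2 : nat -> R)
    (r1 r2 b c : R) :
    N @ \oo --> \oo -> e1 @ \oo --> (0 : R) -> e2 @ \oo --> (0 : R) ->
    (forall k, (N k)%:R * r1 <= L1 k) -> (forall k, (N k)%:R * r2 <= L2 k) ->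
    (forall k, L1 k + L2 k <= (N k)%:R * b + c + e1 k * L1 k + e2 k * L2 k) ->
  r1 + r2 <= b.
Proof.
move=> Noo e10 e20 L1r L2r bound.
have invN : (N k)%:R^-1 @[k --> \oo] --> (0 : R).
  apply/gtr0_cvgV0; last exact/cvgrnyP.
  have /cvgnyPgt/(_ 0%N) := Noo; apply: filterS => k; by rewrite ltr0n.
have lhs : ((1 - e1 k) * r1 + (1 - e2 k) * r2) @[k --> \oo] -->
    (1 - 0) * r1 + (1 - 0) * r2.
  by apply: cvgD; apply: cvgMr_tmp; apply: cvgB => //; exact: cvg_cst.
have rhs : (b + c * (N k)%:R^-1) @[k --> \oo] --> b + c * 0.
  by apply: cvgD; [exact: cvg_cst|apply: cvgMl_tmp].
rewrite subr0 !mul1r mulr0 addr0 in lhs rhs.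
apply: (ler_cvg_to lhs rhs).
(* Makes the factors [1 - e k] nonnegative, so that lower bounds on [L1] and [L2] may be multiplied
   by them. *)
have le1 (e : nat -> R) : e @ \oo --> (0 : R) -> \forall k \near \oo, e k <= 1.
  by move=> e0; apply: (cvgr_le _ e0).
have /cvgnyPgt/(_ 0%N) N0 := Noo.
near=> k.
have Nk : 0 < (N k)%:R :> R by rewrite ltr0n; near: k.
have e1k : e1 k <= 1 by near: k; exact: le1.
have e2k : e2 k <= 1 by near: k; exact: le1.
rewrite -(ler_pM2l Nk) !mulrDr [_ * (c * _)]mulrCA divff ?gt_eqF// mulr1.
have h1 : (1 - e1 k) * ((N k)%:R * r1) <= (1 - e1 k) * L1 k.
  by rewrite ler_wpM2l ?subr_ge0.
have h2 : (1 - e2 k) * ((N k)%:R * r2) <= (1 - e2 k) * L2 k.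
  by rewrite ler_wpM2l ?subr_ge0.
have := bound k; rewrite ![_%:R * ((1 - _) * _)]mulrCA.
move: h1 h2; rewrite ![(1 - _) * L1 _]mulrBl ![(1 - _) * L2 _]mulrBl; lra.
Unshelve. all: by end_near.
Qed.

Lemma achievable_bounds (m n C : nat) (r : R * R) : (n <= m)%N ->
    achievable R m n C r ->
  [/\ r.1 <= m%:R, r.2 <= m%:R & r.1 + r.2 <= 2 * m%:R - n%:R + C%:R].
Proof.
move=> nm [_ _ [N [s [code Noo e1 e2 _]]]].
have qm : maxn m n = m by exact/maxn_idPl.
have rate i k := log2_message_count (N k) (i r).
have zero : (fun=> 0 : R) @ \oo --> (0 : R) by exact: cvg_cst.
split.
(* A single rate is the case where the second rate, error and message length are zero. *)
- rewrite -[leLHS]addr0; apply: (asymptotic_rate_bound (c := 1) Noo e1 zero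
    (rate fst) (L2 := fun=> 0)) => k; first by rewrite mulr0.
  by rewrite mul0r !addr0; have := code_rate1 (code k); rewrite qm.
- rewrite -[leLHS]addr0; apply: (asymptotic_rate_bound (c := 1) Noo e2 zero
    (rate snd) (L2 := fun=> 0)) => k; first by rewrite mulr0.
  by rewrite mul0r !addr0; have := code_rate2 (code k); rewrite qm.
- apply: (asymptotic_rate_bound (c := 2) Noo e1 e2 (rate fst) (rate snd)) => k.
  have := code_sum_rate (code k); rewrite qm natrB//.
  by rewrite (_ : C%:R + m%:R + _ = 2 * m%:R - n%:R + C%:R)//; ring.
Qed.

End Asymptotics.

Theorem theorem1 (R : realType) (m n C : nat) (hm : (1 <= m)%N)
    (alpha : R) (halpha : alpha = n%:R / m%:R) (halpha01 : 0 <= alpha <= 1)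
    (R1 R2 : R) (hR : secrecy_capacity_region R m n C (R1, R2)) :
  [/\ R1 <= m%:R, R2 <= m%:R & R1 + R2 <= 2 * m%:R - n%:R + C%:R].
Proof.
have nm : (n <= m)%N.
  move: halpha01; rewrite halpha => /andP[_].
  by rewrite ler_pdivrMr ?ltr0n// mul1r ler_nat.
have closed_half (f : R * R -> R) b : continuous f -> closed [set r | f r <= b].
  by move=> cf; apply: (preimage_closed (D := [set x | x <= b])) => [x _|];
    [exact: cf|exact: closed_le].
(* Non-strict bounds on continuous functions of the rates define closed sets, so they extend from
   achievable pairs to the closure. *)
have cl (f : R * R -> R) b : continuous f ->
    (forall r, achievable R m n C r -> f r <= b) -> f (R1, R2) <= b.
  move=> cf fb; have := closureS fb hR.
  by rewrite -(closure_id _).1//; exact: closed_half.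
split.
- by apply: (cl fst) => [x|r /(achievable_bounds nm)[]//]; exact: cvg_fst.
- by apply: (cl snd) => [x|r /(achievable_bounds nm)[]//]; exact: cvg_snd.
- apply: (cl (fun r => r.1 + r.2)) => [x|r /(achievable_bounds nm)[]//].
  by apply: cvgD; [exact: cvg_fst|exact: cvg_snd].
Qed.
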